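(* Let $m>n$ be positive integers, let $\mathbf{d}=(d_1,\dots,d_n)$ be integers with $0<d_1<\dots<d_n<m$, and let $\mathbf{f}=(f_1,\dots,f_{n-1})$ be a tuple of linear endomorphisms of $\mathbb{C}^m$. The quiver Grassmannian $\mathrm{Gr}_{\mathbf{d}}(M_{\mathbf{f}})\simeq \mathcal{F}l^{\mathbf{f}}_{\mathbf{d}}(\mathbb{C}^m)$ is an irreducible algebraic variety if and only if for all $i\in\{1,\dots,n-1\}$ either $d_{i+1}-d_i\ge m-\mathrm{rk}\, f_i$ or $\mathrm{rk}\, f_i=0$.
   Context: The linear degeneration $\mathcal{F}l^{\mathbf{f}}_{\mathbf{d}}(\mathbb{C}^m)$ is the algebraic variety (closed in $\mathrm{Gr}_{d_1}(\mathbb{C}^m)\times\dots\times \mathrm{Gr}_{d_n}(\mathbb{C}^m)$) of tuples $(V_1,\dots,V_n)$ of linear subspaces of $\mathbb{C}^m$ with $\dim V_i=d_i$ for all $i$ and $f_i(V_i)\subset V_{i+1}$ for $1\le i\le n-1$. $M_{\mathbf{f}}$ denotes the representation $\mathbb{C}^m\xrightarrow{f_1}\mathbb{C}^m\xrightarrow{f_2}\cdots\xrightarrow{f_{n-1}}\mathbb{C}^m$ of the equioriented quiver of type $A_n$, and $\mathrm{Gr}_{\mathbf{d}}(M_{\mathbf{f}})$ is the variety of its subrepresentations of dimension vector $\mathbf{d}$, which is identified with $\mathcal{F}l^{\mathbf{f}}_{\mathbf{d}}(\mathbb{C}^m)$. *)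

(* Defs.v *)
From HB Require Import structures.
From mathcomp Require Import all_boot all_algebra.
From mathcomp Require Import classical_sets reals complex.
From mathcomp Require Import mpoly.

Set Implicit Arguments.
Unset Strict Implicit.
Unset Printing Implicit Defensive.

Import GRing.Theory.

Local Open Scope ring_scope.
Local Open Scope classical_set_scope.

(* The equioriented quiver of type A_n: vertices 'I_n, arrows 'I_n.-1, with
   arrow i going from vertex i to vertex i.+1 (indices start at 0). *)
Definition arrow_src (n : nat) (i : 'I_n.-1) : 'I_n :=
  widen_ord (leq_pred n) i.

Fact arrow_tgt_subproof (n : nat) (i : 'I_n.-1) : (i.+1 < n)%N.
Proof. by rewrite -ltn_predRL. Qed.

Definition arrow_tgt (n : nat) (i : 'I_n.-1) : 'I_n :=
  Ordinal (arrow_tgt_subproof i).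

Definition rk (K : fieldType) (m : nat) (g : 'End('cV[K]_m)) : nat :=
  \dim (limg g).

Definition grassmannian (K : fieldType) (m d : nat) : Type :=
  {V : {vspace 'cV[K]_m} | \dim V == d}.

Definition grassmannian_prod (K : fieldType) (m n : nat) (d : 'I_n -> nat) :
  Type := forall i : 'I_n, grassmannian K m (d i).

Section Zariski.
Variables (K : fieldType) (m n : nat) (d : 'I_n -> nat).

Definition grassmannian_basis (k : nat) (V : grassmannian K m k) :
  'M[K]_(m, k) := \matrix_(a < m, b < k) (vbasis (val V))`_b a 0.

Definition subset_of_card (k : nat) := {I : {set 'I_m} | #|I| == k}.

Definition subset_row (k : nat) (I : subset_of_card k) (a : 'I_k) : 'I_m :=
  enum_val (cast_ord (esym (eqP (valP I))) a).

(* The Pluecker coordinates of V: the maximal minors of a matrix whose columns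
   form a basis of V.  Another basis multiplies all of them by the same nonzero
   scalar, which does not affect the vanishing of homogeneous polynomials. *)
Definition pluecker (k : nat) (V : grassmannian K m k) (I : subset_of_card k) :
  K := \det (rowsub (subset_row I) (grassmannian_basis V)).

(* The homogeneous coordinates on the product of the projective spaces
   P(Lambda^(d i) K^m), i < n. *)
Definition pluecker_index := {i : 'I_n & subset_of_card (d i)}.

Definition pluecker_poly := {mpoly K[#|{: pluecker_index}|]}.

Definition multihomogeneous (p : pluecker_poly) : Prop :=
  exists e : 'I_n -> nat, forall mon, mon \in msupp p ->
    forall i, (\sum_(k | tag (enum_val k) == i) mon k)%N = e i.

Definition pluecker_eval (V : grassmannian_prod K m d) (p : pluecker_poly) : K :=
  p.@[fun k => let t := enum_val k in pluecker (V (tag t)) (tagged t)].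

(* Closed sets of the Zariski topology on the product of Grassmannians, embedded
   in a product of projective spaces by the Pluecker embeddings.  The set S may
   be infinite; by Noetherianity this gives no more closed sets. *)
Definition zariski_closed (Z : set (grassmannian_prod K m d)) : Prop :=
  exists2 S : set pluecker_poly,
    (forall p, S p -> multihomogeneous p) &
    Z = [set V | forall p, S p -> pluecker_eval V p = 0].

Definition zariski_closed_in (X Z : set (grassmannian_prod K m d)) : Prop :=
  exists2 F, zariski_closed F & Z = X `&` F.

Definition zariski_irreducible (X : set (grassmannian_prod K m d)) : Prop :=
  X !=set0 /\
  forall Z1 Z2, zariski_closed_in X Z1 -> zariski_closed_in X Z2 ->
    X = Z1 `|` Z2 -> X = Z1 \/ X = Z2.

End Zariski.

(* A family f : 'I_n.-1 -> 'End('cV[K]_m) is the representation M_f of the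
   quiver with K^m at every vertex and f i on the arrow i. *)
Definition is_subrep (K : fieldType) (m n : nat)
    (f : 'I_n.-1 -> 'End('cV[K]_m)) (V : 'I_n -> {vspace 'cV[K]_m}) : Prop :=
  forall i : 'I_n.-1, (f i @: V (arrow_src i) <= V (arrow_tgt i))%VS.

(* Subrepresentations of M_f of dimension vector d; unfolding is_subrep, this is
   literally the linear degenerate flag variety Fl^f_d(K^m). *)
Definition quiver_grassmannian (K : fieldType) (m n : nat)
    (f : 'I_n.-1 -> 'End('cV[K]_m)) (d : 'I_n -> nat) :
  set (grassmannian_prod K m d) := [set V | is_subrep f (fun i => val (V i))].

Arguments quiver_grassmannian {K m n} f d.

(* Main.v *)
Require Import Defs.
From HB Require Import structures.
From mathcomp Require Import all_boot all_order all_algebra perm.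
From mathcomp Require Import classical_sets reals complex.
From mathcomp Require Import mpoly zify ring.

Set Implicit Arguments.
Unset Strict Implicit.
Unset Printing Implicit Defensive.

Import Order.TTheory GRing.Theory Num.Theory.

Local Open Scope ring_scope.

(** Write [X] for the quiver Grassmannian, [F_ab] for the composite of the maps
    [f] from vertex [a] to vertex [b], and [V_i] for the spaces of a point of
    [X].  A projective variety is irreducible exactly when it is nonempty and any
    two multihomogeneous polynomials, each nonzero somewhere on it, are nonzero
    at a common point ([zariski_irreducibleP]); both directions are proved in
    this form.

    Sufficiency.  Let [U] be the set of points of [X] for which every nonzero
    [f_i] is injective on [V_i].  Points of [U] have bases of the [V_i] whose
    members at vertex [i+1] start with the images of those at vertex [i] when
    [f_i] is nonzero, the others being free ([flow], [flow_frame]).  So [U] is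
    the image of an open subset of an affine space, and two points of [U] can
    be joined by a line of parameters, on which polynomials that are not
    identically zero have a common nonzero.

    It remains to see that [U] is dense ([injective_points_dense]).  If a
    nonzero [x] in [V_i] is killed by [f_i], with [f_i] nonzero, write it as
    [F_ji z], with [z] in [V_j] and [j] minimal.  Minimality gives a functional
    [l] with [l x = 1] that vanishes on the image of [V_(j-1)].  The maps
    between [j] and [i+1] are nonzero, so the hypothesis on the ranks adds up
    to [dim (ker F_j(i+1)) <= d_(i+1) - d_j]; hence the preimage of [V_(i+1)]
    under [F_j(i+1)] is big enough to contain a [y] whose image is not in
    [F_j(i+1) V_j].  The shears
    [1 + t (l o F_ki) (F_jk y)] at the vertices [k] from [j] to [i], and the
    identity elsewhere, then move the given point inside [X], and for
    [t] nonzero the rank of [F_j(i+1)] on [V_j] goes up while no other rank of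
    an [F_ab] on [V_a] goes down ([total_rank_deformation]).  After finitely
    many such moves, each with [t] generic so as not to leave a given open
    set, the point is in [U].

    Necessity.  Since dimensions increase along the quiver, [V_i] can be any
    subspace of the right dimension ([subrep_through]).  Choose a complement [L]
    of some [V_i] that is comparable with [ker f_i] and a complement [L'] of some
    [V_(i+1)] that is comparable with [im f_i].  Being transversal to [L] or to
    [L'] is an open condition, given by a linear form in the Pluecker coordinates
    ([transversality_open]), so irreducibility provides a point with both
    properties.  At this point [V_i] meets [ker f_i] and [V_(i+1)] meets [im f_i]
    as little as possible, and [f_i V_i] can only fit into [V_(i+1)] if the rank
    condition holds or [f_i = 0] ([corank_le_of_transversal]). *)

(** * Subspaces and endomorphisms *)

Section LinearAlgebra.
Variables (K : fieldType) (T : vectType K).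
Implicit Types (U V W S : {vspace T}) (f g : 'End(T)).

Lemma vspace_between U V k :
  (U <= V)%VS -> (\dim U <= k <= \dim V)%N ->
  exists W, [/\ (U <= W)%VS, (W <= V)%VS & \dim W = k].
Proof.
move=> UV /andP[Uk].
elim: k Uk => [|k IHk] Uk kV; first by exists U; rewrite subvv UV; split=> //; lia.
have [Ek|Uk'] := eqVneq (\dim U) k.+1; first by exists U; rewrite subvv.
have [||W [UW WV dW]] := IHk; [lia|exact: ltnW|].
have /subvPn[x xV xW] : ~~ (V <= W)%VS.
  by apply/negP => /dimvS; rewrite dW; lia.
exists (W + <[x]>)%VS; split.
- exact: subv_trans UW (addvSl _ _).
- by rewrite subv_add WV -memvE.
- have x0 : x != 0 by apply: contraNneq xW => ->; rewrite mem0v.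
  have dx : directv (W + <[x]>).
    apply/directv_addP/eqP; rewrite -subv0; apply/subvP => y.
    rewrite memv_cap => /andP[yW /vlineP[c yE]]; rewrite memv0.
    have [c0|c0] := eqVneq c 0; first by rewrite yE c0 scale0r.
    by case/negP: xW; rewrite -(scale1r x) -(mulVf c0) -scalerA -yE memvZ.
  by rewrite (directvP dx) /= dim_vline x0 dW addn1.
Qed.

(** The coordinates of [v - projv S v] vanish for [v] in [S], and one of them does
    not vanish at [x]. *)
Lemma separating_functional S (x : T) : x \notin S ->
  exists2 l : 'Hom(T, K^o), l x = 1 & forall v, v \in S -> l v = 0.
Proof.
move=> xS; pose w v := v - projv S v.
have wx : w x != 0.
  by apply: contraNneq xS => /eqP; rewrite subr_eq0 => /eqP->; exact: memv_proj.
have [i ci] : exists i, coord (vbasis fullv) i (w x) != 0.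
  apply/existsP; apply: contraNT wx; rewrite negb_exists => /forallP c0.
  rewrite (coord_vbasis (memvf (w x))) big1 // => i _.
  by move: (c0 i); rewrite negbK => /eqP->; rewrite scale0r.
set c := coord _ _ _ in ci.
pose u := (\1 - projv S)%VF.
have uE v : u v = w v by rewrite /u add_lfunE opp_lfunE id_lfunE.
exists (c^-1 *: (linfun (coord (vbasis fullv) i : T -> K^o) \o u)%VF).
  by rewrite scale_lfunE comp_lfunE lfunE /= uE -/c; exact: mulVf.
move=> v vS; rewrite scale_lfunE comp_lfunE uE /w projv_id // subrr.
by rewrite linear0 scaler0.
Qed.

Definition rank_one_fun (l : 'Hom(T, K^o)) (y : T) (v : T) : T := (l v : K) *: y.

Fact rank_one_linear l y : linear (rank_one_fun l y).
Proof.
move=> a u v; rewrite /rank_one_fun linearP scalerDl; congr (_ + _).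
by rewrite scalerA.
Qed.
HB.instance Definition _ l y :=
  GRing.isLinear.Build K T T *:%R (rank_one_fun l y) (rank_one_linear l y).

Definition rank_one l y : 'End(T) := linfun (rank_one_fun l y).

Lemma rank_oneE l y v : rank_one l y v = (l v : K) *: y.
Proof. by rewrite lfunE. Qed.

Lemma dim_limg_inj g V : lker g == 0%VS -> \dim (g @: V) = \dim V.
Proof. by move/eqP=> g0; apply: limg_dim_eq; rewrite g0 capv0. Qed.

Lemma dim_lker_comp f g :
  (\dim (lker (g \o f)) <= \dim (lker f) + \dim (lker g))%N.
Proof.
set k := lker (g \o f)%VF; rewrite -(limg_ker_dim f k); apply: leq_add.
  by apply: dimvS; exact: capvSr.
apply: dimvS; apply/subvP => _ /memv_imgP[v vk ->].
by rewrite memv_ker -comp_lfunE -memv_ker.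
Qed.

Lemma dim_lker_limg f : (\dim (lker f) + \dim (limg f) = \dim {: T})%N.
Proof. by rewrite -(limg_ker_dim f fullv) capfv. Qed.

Lemma dim_preim_ge f W :
  (\dim (lker f) + \dim W + \dim (limg f) <= \dim (f @^-1: W) + \dim {: T})%N.
Proof.
rewrite -(limg_ker_dim f (f @^-1: W)) -lpreim_cap_limg lpreimK ?capvSr //.
have -> : ((f @^-1: (W :&: limg f)) :&: lker f)%VS = lker f.
  by apply/capv_idPr; rewrite -lpreim0; apply/lpreimS/sub0v.
rewrite -!addnA leq_add2l -dimv_sum_cap addnC leq_add2l.
exact/dimvS/subvf.
Qed.

(** Comparability makes the transversality to [L] and [L'] control [ker f] and
    [im f]: [U] meets [ker f] trivially if [ker f <= L], and otherwise spans
    everything together with it; likewise for [W] and [im f].  The four cases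
    are then dimension counts inside [f U <= W :&: im f]. *)
Lemma corank_le_of_transversal f U W L L' :
  (f @: U <= W)%VS -> (U :&: L = 0)%VS -> (W :&: L' = 0)%VS ->
  (lker f <= L)%VS \/ (L <= lker f)%VS ->
  (limg f <= L')%VS \/ (L' <= limg f)%VS ->
  (\dim U + \dim L = \dim {: T})%N -> (\dim W + \dim L' = \dim {: T})%N ->
  (0 < \dim U)%N -> (\dim W < \dim {: T})%N ->
  (\dim {: T} + \dim U <= \dim W + \dim (limg f))%N \/ \dim (limg f) = 0%N.
Proof.
move=> fUW UL WL' KL RL' dUL dWL' U0 WT.
have dimU := limg_ker_dim f U; have dimK := dim_lker_limg f.
have dimW := dimv_sum_cap W (limg f); have dimUK := dimv_sum_cap U (lker f).
have dimUL := dimv_sum_cap U L; have dimWL := dimv_sum_cap W L'.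
rewrite UL dimv0 in dimUL; rewrite WL' dimv0 in dimWL.
have fU_le : (\dim (f @: U) <= \dim (W :&: limg f))%N.
  by apply: dimvS; rewrite subv_cap fUW limgS ?subvf.
case: KL => [/(capvS (subvv U))/dimvS|/(addvS (subvv U))/dimvS];
case: RL' => [/(capvS (subvv W))/dimvS|/(addvS (subvv W))/dimvS];
  rewrite ?UL ?WL' ?dimv0; clear UL WL' fUW; lia.
Qed.

End LinearAlgebra.

(** * Deforming a subrepresentation to increase ranks *)

Section Representations.
Variables (K : fieldType) (T : vectType K) (n : nat) (f : nat -> 'End(T)).
Implicit Types (W : nat -> {vspace T}).

Fixpoint path_map (a b : nat) : 'End(T) :=
  if b is b'.+1 then
    if (a <= b')%N then (f b' \o path_map a b')%VF else \1%VF
  else \1%VF.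

Lemma path_map_id a b : (b <= a)%N -> path_map a b = \1%VF.
Proof. by case: b => //= b; rewrite ltnNge => /negbTE->. Qed.

Lemma path_mapS a b v : (a <= b)%N -> path_map a b.+1 v = f b (path_map a b v).
Proof. by move=> /= ->; rewrite comp_lfunE. Qed.

Lemma path_map_comp a b c v : (a <= b)%N -> (b <= c)%N ->
  path_map a c v = path_map b c (path_map a b v).
Proof.
move=> ab; elim: c => [|c IHc] bc.
  by rewrite !path_map_id ?id_lfunE //; lia.
have [bc'|cb] := leqP b c.
  by rewrite !path_mapS ?(leq_trans ab) // IHc.
have -> : b = c.+1 by lia.
by rewrite (path_map_id (leqnn c.+1)) id_lfunE.
Qed.

Lemma path_mapSl a b v : (a < b)%N -> path_map a b v = path_map a.+1 b (f a v).
Proof.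
move=> ab; rewrite (@path_map_comp a a.+1) // path_mapS //.
by rewrite (path_map_id (leqnn a)) id_lfunE.
Qed.

Lemma path_map_eq0 a k b : f k = 0 -> (a <= k)%N -> (k < b)%N -> path_map a b = 0.
Proof.
move=> fk ak kb; apply/lfunP => v.
rewrite (@path_map_comp a k.+1) ?path_mapS ?fk ?zero_lfunE ?linear0 //; lia.
Qed.

Definition nat_subrep W :=
  forall k, (k.+1 < n)%N -> (f k @: W k <= W k.+1)%VS.

Lemma path_map_mem W a b v : nat_subrep W -> (a <= b)%N -> (b < n)%N ->
  v \in W a -> path_map a b v \in W b.
Proof.
move=> sW; elim: b => [|b IHb] ab bn va.
  by move: ab va; rewrite leqn0 => /eqP->; rewrite /= id_lfunE.
have [ab'|ba] := leqP a b.
  rewrite path_mapS //; apply: (subvP (sW _ bn)); apply: memv_img.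
  by apply: IHb => //; lia.
have Eb : a = b.+1 by lia.
by rewrite -Eb path_map_id // id_lfunE.
Qed.

Section Deformation.
Variable d : nat -> nat.
Hypothesis d_lt : forall k, (k.+1 < n)%N -> (d k < d k.+1)%N.
Hypothesis f_rank : forall k, (k.+1 < n)%N ->
  f k != 0 -> (\dim (lker (f k)) <= d k.+1 - d k)%N.

(** Coranks are subadditive under composition, so the increments of [d] that
    bound them telescope. *)
Lemma dim_lker_path_map a b : (a <= b)%N -> (b < n)%N ->
  (forall k, (a <= k < b)%N -> f k != 0) ->
  (\dim (lker (path_map a b)) + d a <= d b)%N.
Proof.
have lker_id : \dim (lker (\1%VF : 'End(T))) = 0%N.
  rewrite (_ : lker _ = 0%VS) ?dimv0 //.
  by apply/eqP/lker0P => u v; rewrite !id_lfunE.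
elim: b => [|b IHb] ab bn f0.
  by rewrite path_map_id // lker_id; move: ab; rewrite leqn0 => /eqP->.
have [ab'|ba] := leqP a b; last first.
  have -> : a = b.+1 by lia.
  by rewrite path_map_id // lker_id.
have f0' k : (a <= k < b)%N -> f k != 0 by move=> kab; apply: f0; lia.
have fb : f b != 0 by apply: f0; lia.
have := IHb ab' (ltnW bn) f0'; have := f_rank bn fb; have := d_lt bn.
have := dim_lker_comp (path_map a b) (f b).
have -> : path_map a b.+1 = (f b \o path_map a b)%VF by rewrite /= ab'.
lia.
Qed.

(** Each summand depends on the space at the source [a] only, so moving the spaces
    at other vertices does not affect it. *)
Definition total_rank W :=
  (\sum_(a < n) \sum_(b < n) \dim (path_map a b @: W a))%N.

Lemma total_rank_bound W : (total_rank W <= n * (n * \dim {: T}))%N.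
Proof.
have cst k : (n * k = \sum_(i < n) k)%N by rewrite sum_nat_const card_ord.
rewrite cst; apply: leq_sum => a _; rewrite cst; apply: leq_sum => b _.
exact/dimvS/subvf.
Qed.

Lemma total_rank_lt W W' (a b : 'I_n) :
  (forall a b : 'I_n, (\dim (path_map a b @: W a) <= \dim (path_map a b @: W' a))%N) ->
  (\dim (path_map a b @: W a) < \dim (path_map a b @: W' a))%N ->
  (total_rank W < total_rank W')%N.
Proof.
move=> le lt; rewrite /total_rank (bigD1 a) //= [X in (_ < X)%N](bigD1 a) //=.
rewrite -addSn; apply: leq_add; last by apply: leq_sum => i _; exact: leq_sum.
rewrite (bigD1 b) //= [X in (_ < X)%N](bigD1 b) //=.
by rewrite -addSn; apply: leq_add => //; exact: leq_sum.
Qed.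

Lemma minimal_source W i x : x \in W i ->
  exists j z, [/\ (j <= i)%N, z \in W j, path_map j i z = x
    & forall k v, (k < j)%N -> v \in W k -> path_map k i v != x].
Proof.
move=> xW; pose P j := x \in (path_map j i @: W j)%VS.
have Pi : exists j, P j by exists i; rewrite /P path_map_id // lim1g.
case: (ex_minnP Pi) => j Pj minj; have /memv_imgP[z zW xE] := Pj.
exists j, z; split=> // [|k v kj vW].
  by apply: minj; rewrite /P path_map_id // lim1g.
apply: contraTneq kj => vx; rewrite -leqNgt; apply: minj.
by rewrite /P -vx memv_img.
Qed.

(** [N k] is the rank one map [(l o F_ki) (F_jk y)] for [j <= k <= i], in the
    notation of the introduction, and [c = l (F_ji y)], which is the value of
    [l o F_ki] on [F_jk y] for each [k].  So [1 + t * c != 0] is the condition for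
    all the shears to be invertible. *)
Lemma total_rank_deformation W i :
  nat_subrep W -> (forall k, (k < n)%N -> \dim (W k) = d k) ->
  (i.+1 < n)%N -> f i != 0 -> (W i :&: lker (f i))%VS != 0%VS ->
  exists (N : nat -> 'End(T)) (c : K), forall t, t != 0 -> 1 + t * c != 0 ->
    let g k := (\1 + t *: N k)%VF in
    [/\ forall k, lker (g k) == 0%VS,
        nat_subrep (fun k => g k @: W k)%VS
      & (total_rank W < total_rank (fun k => g k @: W k)%VS)%N].
Proof.
move=> sW dW iN fi0; rewrite -vpick0.
set x := vpick _ => x0.
have := memv_pick (W i :&: lker (f i))%VS; rewrite -/x memv_cap memv_ker.
case/andP=> xW /eqP fx.
have [j [z [ji zW zx minj]]] := minimal_source xW.
have Fji0 : path_map j i != 0.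
  by apply: contraNneq x0 => F0; rewrite -zx F0 zero_lfunE.
set G := path_map j i.+1.
have Gz : G z = 0 by rewrite /G path_mapS // zx.
have z0 : z != 0 by apply: contraNneq x0 => z0; rewrite -zx z0 linear0.
(* By minimality of [j], [x] does not come from the vertex before [j]. *)
pose S := (if j is j'.+1 then path_map j' i @: W j' else 0)%VS.
have xS : x \notin S.
  rewrite /S; case: (j) minj => [|j'] minj; first by rewrite memv0.
  by apply/negP => /memv_imgP[v vW xE]; have := minj j' v (ltnSn _) vW; rewrite -xE eqxx.
have [l lx lS] := separating_functional xS.
(* [z] is killed by [G], so [G (W j)] has dimension less than [d j], while
   [W i.+1 :&: limg G] has dimension at least [d j]. *)
have [y Gy nGy] : exists2 y, G y \in W i.+1 & G y \notin (G @: W j)%VS.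
  suff /subvPn[u] : ~~ (W i.+1 :&: limg G <= G @: W j)%VS.
    rewrite memv_cap => /andP[uW /memv_imgP[y _ uE]] nu.
    by exists y; rewrite -uE.
  apply/negP => /dimvS.
  have zk : (0 < \dim (W j :&: lker G))%N.
    rewrite lt0n dimv_eq0; apply: contraNneq z0 => E.
    by rewrite -memv0 -E memv_cap zW memv_ker Gz eqxx.
  have := limg_ker_dim G (W j).
  have := dimv_sum_cap (W i.+1) (limg G).
  have := dim_lker_limg G; have := dimvS (subvf (W i.+1 + limg G)%VS).
  have f0 k : (j <= k < i.+1)%N -> f k != 0.
    move=> /andP[jk ki]; have [->//|ki'] := eqVneq k i.
    by apply: contraNneq Fji0 => fk; rewrite (path_map_eq0 fk) //; lia.
  have := dim_lker_path_map (leqW ji) iN f0.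
  rewrite -/G !dW //; last by lia.
  lia.
pose mu k := (l \o path_map k i)%VF.
pose N k := if (j <= k <= i)%N then rank_one (mu k) (path_map j k y) else 0.
pose c : K := l (path_map j i y).
exists N, c => t t0 tc g.
have gE k v : (j <= k <= i)%N -> g k v = v + (t * (mu k v : K)) *: path_map j k y.
  move=> kji; rewrite /g add_lfunE scale_lfunE id_lfunE /N kji rank_oneE.
  by rewrite scalerA.
have gid k : ~~ (j <= k <= i)%N -> g k = \1%VF.
  by move=> kji; rewrite /g /N (negbTE kji) scaler0 addr0.
clearbody g.
have muE k v : mu k v = l (path_map k i v) by rewrite /mu comp_lfunE.
have mu_y k : (j <= k <= i)%N -> mu k (path_map j k y) = c.
  by move=> /andP[jk ki]; rewrite muE -path_map_comp.
clearbody c mu N.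
have mu_path a b v : (a <= b <= i)%N -> mu b (path_map a b v) = mu a v.
  by move=> /andP[ab bi]; rewrite !muE -path_map_comp.
(* Both sides add the same multiple of [path_map j b y] to [path_map a b v]. *)
have gpath a b v : (j <= a)%N -> (a <= b <= i)%N ->
    path_map a b (g a v) = g b (path_map a b v).
  move=> ja abi; rewrite !gE; try by clear - ja abi; lia.
  by rewrite linearD linearZ /= mu_path // -path_map_comp //; clear - ja abi; lia.
have glker k : lker (g k) == 0%VS.
  have [kji|kji] := boolP (j <= k <= i)%N; last first.
    by rewrite gid //; apply/lker0P => u v; rewrite !id_lfunE.
  rewrite -subv0; apply/subvP => v; rewrite memv_ker memv0 => /eqP gv.
  have muv : (mu k v : K) = 0.
    have : mu k (g k v) = 0 by rewrite gv linear0.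
    rewrite gE // linearD linearZ /= mu_y //.
    move=> E; have {E} : (mu k v : K) * (1 + t * c) = 0.
      by rewrite -[RHS]E /GRing.scale /=; ring.
    by move/eqP; rewrite mulf_eq0 (negbTE tc) orbF => /eqP.
  by move: gv; rewrite gE // muv mulr0 scale0r addr0 => ->.
(* [za] spans a complement in [W a] of the kernel of [mu a]; [path_map a b] kills
   [za], and [g a] is the identity on this kernel. *)
have gW_ge a b : (j <= a <= i)%N -> (i < b)%N ->
    (path_map a b @: W a <= path_map a b @: (g a @: W a))%VS.
  move=> aji ib; set za := path_map j a z.
  have zaW : za \in W a by apply: path_map_mem => //; clear - aji iN; lia.
  have mu_za : (mu a za : K) = 1.
    by rewrite muE /za -path_map_comp ?zx //; clear - aji; lia.
  have Fza : path_map a b za = 0.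
    rewrite (@path_map_comp a i.+1) ?[path_map a _ _]path_mapS; try by clear - aji ib; lia.
    by rewrite /za -path_map_comp ?zx ?fx ?linear0 //; clear - aji; lia.
  apply/subvP => _ /memv_imgP[v vW ->].
  pose v' := v - (mu a v : K) *: za.
  have -> : path_map a b v = path_map a b (g a v').
    have muv' : (mu a v' : K) = 0.
      rewrite /v' linearB linearZ /= mu_za /GRing.scale /= mulr1.
      exact: subrr.
    rewrite gE // muv' mulr0 scale0r addr0.
    by rewrite /v' linearB linearZ /= Fza scaler0 subr0.
  by rewrite !memv_img // /v' rpredB // rpredZ.
split=> // [k kn|].
- have [kji|kji] := boolP (j <= k <= i)%N; last first.
    rewrite (gid k) // lim1g; have [kj|kj] := eqVneq k.+1 j.
      (* [mu j] vanishes on the image of [W k], since [l] vanishes on [S]. *)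
      apply/subvP => _ /memv_imgP[v vW ->]; rewrite kj.
      have fvW : f k v \in W j.
        by rewrite -kj; apply: (subvP (sW _ kn)); exact: memv_img.
      suff <- : g j (f k v) = f k v by exact: memv_img.
      rewrite gE ?leqnn ?ji // -kj muE -path_mapSl; last by clear - ji kj; lia.
      rewrite lS ?mulr0 ?scale0r ?addr0 // /S -kj.
      exact: memv_img.
    by rewrite gid ?lim1g ?sW //; clear - kji kj; lia.
  have [ki|ki] := eqVneq k i.
    (* Here [f i] sends the direction of the shear to [G y], which is in [W i.+1]. *)
    subst k; rewrite (gid i.+1) ?lim1g; last by rewrite ltnn andbF.
    apply/subvP => _ /memv_imgP[_ /memv_imgP[v vW ->] ->].
    rewrite gE // linearD linearZ /= -path_mapS //.
    rewrite rpredD ?rpredZ //.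
    by apply: (subvP (sW _ iN)); exact: memv_img.
  apply/subvP => _ /memv_imgP[_ /memv_imgP[v vW ->] ->].
  have fE u : f k u = path_map k k.+1 u by rewrite path_mapS // path_map_id // id_lfunE.
  rewrite fE gpath; try by clear - kji ki; lia.
  rewrite -fE; apply/memv_img/(subvP (sW _ kn)); exact: memv_img.
- apply: (@total_rank_lt _ _ (Ordinal (leq_ltn_trans ji (ltnW iN))) (Ordinal iN)) => /=.
    move=> a b.
    have [aji|aji] := boolP (j <= a <= i)%N; last by rewrite (gid a) // lim1g.
    have [bi|ib] := leqP b i; last exact/dimvS/gW_ge.
    have [ba|ab] := leqP b a.
      by rewrite path_map_id // !lim1g dim_limg_inj.
    rewrite -!limg_comp (_ : path_map a b \o g a = g b \o path_map a b)%VF.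
      by rewrite limg_comp (dim_limg_inj _ (glker b)).
    by apply/lfunP => v; rewrite !comp_lfunE gpath //; clear - aji bi ab; lia.
  have jji : (j <= j <= i)%N by rewrite leqnn.
  rewrite ltnNge; apply: contra nGy => leG.
  (* [g j z = z + t *: y] and [G z = 0], so [G y] lies in the new image. *)
  have /eqP-> : (G @: W j == G @: (g j @: W j))%VS by rewrite eqEdim gW_ge.
  have -> : G y = t^-1 *: G (g j z).
    rewrite gE // linearD linearZ /= Gz add0r.
    rewrite muE zx lx mulr1 path_map_id // id_lfunE.
    by rewrite scalerA mulVf // scale1r.
  by rewrite rpredZ // !memv_img.
Qed.

End Deformation.
End Representations.

(** * Polynomial functions of one parameter, and frames of subspaces *)

Section PolynomialFunctions.
Variable K : numFieldType.
Implicit Types (g h : K -> K) (P Q : K -> Prop).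

Definition polyfun g := exists q : {poly K}, forall t, g t = q.[t].

Lemma polyfun_cst c : polyfun (fun=> c).
Proof. by exists c%:P => t; rewrite hornerC. Qed.

Lemma polyfun_id : polyfun (fun t => t).
Proof. by exists 'X => t; rewrite hornerX. Qed.

Lemma polyfun_add g h : polyfun g -> polyfun h -> polyfun (fun t => g t + h t).
Proof. by move=> [p gp] [q hq]; exists (p + q) => t; rewrite hornerD gp hq. Qed.

Lemma polyfun_mul g h : polyfun g -> polyfun h -> polyfun (fun t => g t * h t).
Proof. by move=> [p gp] [q hq]; exists (p * q) => t; rewrite hornerM gp hq. Qed.

Lemma polyfun_exp g k : polyfun g -> polyfun (fun t => g t ^+ k).
Proof. by move=> [p gp]; exists (p ^+ k) => t; rewrite horner_exp gp. Qed.

Lemma polyfun_sum (I : Type) (r : seq I) (g : I -> K -> K) :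
  (forall i, polyfun (g i)) -> polyfun (fun t => \sum_(i <- r) g i t).
Proof.
move=> pg; elim: r => [|i r [q IHr]].
  by exists 0 => t; rewrite big_nil horner0.
have [p gp] := pg i.
by exists (p + q) => t; rewrite big_cons hornerD gp IHr.
Qed.

Lemma polyfun_prod (I : Type) (r : seq I) (g : I -> K -> K) :
  (forall i, polyfun (g i)) -> polyfun (fun t => \prod_(i <- r) g i t).
Proof.
move=> pg; elim: r => [|i r [q IHr]].
  by exists 1 => t; rewrite big_nil hornerC.
have [p gp] := pg i.
by exists (p * q) => t; rewrite big_cons hornerM gp IHr.
Qed.

Lemma polyfun_det k (A : K -> 'M[K]_k) :
  (forall a b, polyfun (fun t => A t a b)) -> polyfun (fun t => \det (A t)).
Proof.
move=> pA; apply: polyfun_sum => s; apply: polyfun_mul; first exact: polyfun_cst.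
exact: polyfun_prod.
Qed.

(** Cofiniteness on the affine line, with a polynomial as witness so that
    conjunctions become products. *)
Definition generic P := exists2 q : {poly K}, q != 0 & forall t, q.[t] != 0 -> P t.

Lemma generic_and P Q : generic P -> generic Q -> generic (fun t => P t /\ Q t).
Proof.
move=> [p p0 pP] [q q0 qQ]; exists (p * q); first by rewrite mulf_neq0.
by move=> t; rewrite hornerM mulf_eq0 negb_or => /andP[/pP ? /qQ ?].
Qed.

Lemma generic_forall (I : finType) (P : I -> K -> Prop) :
  (forall i, generic (P i)) -> generic (fun t => forall i, P i t).
Proof.
move=> gP.
suff [q q0 qP] : generic (fun t => forall i, i \in enum I -> P i t).
  by exists q => // t /qP Pt i; apply: Pt; rewrite mem_enum.
elim: (enum I) => [|i s IHs]; first by exists 1 => //; exact: oner_neq0.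
have [q q0 qP] := generic_and (gP i) IHs.
exists q => // t /qP[Pi Ps] j; rewrite inE => /predU1P[->|] //; exact: Ps.
Qed.

(** A nonzero polynomial of size [k] cannot vanish at [0, ..., k - 1]. *)
Lemma generic_ex P : generic P -> exists t, P t.
Proof.
move=> [q q0 qP]; pose s := [seq i%:R | i <- iota 0 (size q)] : seq K.
have [/hasP[t _ qt]|/hasPn qs] := boolP (has (fun t => q.[t] != 0) s).
  by exists t; exact: qP.
have us : uniq s by rewrite map_inj_uniq ?iota_uniq //; exact: mulrIn (oner_neq0 K).
have rs : all (root q) s.
  by apply/allP => t /qs; rewrite negbK.
by have := max_poly_roots q0 rs us; rewrite size_map size_iota ltnn.
Qed.

Lemma generic_neq0 g t0 : polyfun g -> g t0 != 0 -> generic (fun t => g t != 0).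
Proof.
move=> [q gq] g0; exists q => [|t]; last by rewrite gq.
by apply: contraNneq g0 => q0; rewrite gq q0 horner0.
Qed.

End PolynomialFunctions.

Lemma row_fullP_inj (K : fieldType) m k (A : 'M[K]_(m, k)) :
  reflect (forall u : 'cV_k, A *m u = 0 -> u = 0) (row_full A).
Proof.
rewrite /row_full -mxrank_tr; apply: (iffP idP) => [fA u Au|inj].
  apply: trmx_inj; apply: (row_free_inj fA).
  by rewrite -trmx_mul Au !trmx0 mul0mx.
apply: (@inj_row_free _ _ _ A^T) => v vA; apply: trmx_inj; rewrite trmx0.
by apply: inj; rewrite -[A]trmxK -trmx_mul vA trmx0.
Qed.

Section Frames.
Variables (K : fieldType) (m : nat).

(** Only when [\dim V = k] does this say that the columns of [A] form a basis of
    [V]. *)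
Definition is_frame k (V : {vspace 'cV[K]_m}) (A : 'M[K]_(m, k)) :=
  (forall b, col b A \in V) /\ row_full A.

Definition cols_of k (s : nat -> 'cV[K]_m) : 'M[K]_(m, k) :=
  \matrix_(a < m, b < k) s b a 0.

Lemma col_cols_of k s (b : 'I_k) : col b (cols_of k s) = s b.
Proof. by apply/colP => a; rewrite !mxE. Qed.

Lemma mulmx_cols k (A : 'M[K]_(m, k)) (u : 'cV_k) :
  A *m u = \sum_b u b 0 *: col b A.
Proof.
apply/colP => a; rewrite mxE summxE; apply: eq_bigr => b _.
by rewrite !mxE mulrC.
Qed.

Lemma free_row_full k (A : 'M[K]_(m, k)) :
  free [tuple col b A | b < k] = row_full A.
Proof.
have nthE (b : 'I_k) : [tuple col b A | b < k]`_b = col b A.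
  by rewrite nth_mktuple.
apply/freeP/row_fullP_inj => [fA u|inj c c0 b].
  rewrite mulmx_cols => Au; apply/colP => b; rewrite [RHS]mxE.
  apply: (fA (fun b => u b 0)); rewrite -[RHS]Au.
  by apply: eq_bigr => i _; rewrite nthE.
have /colP/(_ b) : (\col_b c b) = 0 :> 'cV_k.
  apply: inj; rewrite mulmx_cols -[RHS]c0.
  by apply: eq_bigr => i _; rewrite nthE mxE.
by rewrite !mxE.
Qed.

Lemma row_full_cols_of k (s : seq 'cV[K]_m) :
  size s = k -> free s -> row_full (cols_of k (nth 0 s)).
Proof.
move=> sk; rewrite -free_row_full; congr is_true; congr free.
apply: (@eq_from_nth _ 0) => [|b bs]; first by rewrite size_tuple.
have bk : (b < k)%N by rewrite -sk.
by rewrite (nth_mktuple _ _ (Ordinal bk)) col_cols_of.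
Qed.

Lemma basis_is_frame k (V : grassmannian K m k) :
  is_frame (val V) (grassmannian_basis V).
Proof.
have sV : size (vbasis (val V)) = k by rewrite size_tuple; exact/eqP/(valP V).
split; last by apply: row_full_cols_of => //; exact/basis_free/vbasisP.
by move=> b; rewrite col_cols_of vbasis_mem // mem_nth // sV.
Qed.

Lemma is_frame_span k (A : 'M[K]_(m, k)) : row_full A ->
  let V := <<[tuple col b A | b < k]>>%VS in \dim V = k /\ is_frame V A.
Proof.
move=> fA V; split.
  suff /vector.size_basis : basis_of V [tuple col b A | b < k] by [].
  by rewrite /basis_of eqxx free_row_full.
split=> // b; apply: memv_span; apply/tnthP; exists b; by rewrite tnth_mktuple.
Qed.

Lemma frame_span k (V : {vspace 'cV[K]_m}) (A : 'M[K]_(m, k)) :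
  is_frame V A -> \dim V = k -> V = <<[tuple col b A | b < k]>>%VS.
Proof.
move=> [AV fA] dV; apply/esym/eqP; rewrite eqEdim.
have [-> _] := is_frame_span fA; rewrite dV leqnn andbT.
by apply/span_subvP => _ /tnthP[b ->]; rewrite tnth_mktuple.
Qed.

Lemma frame_mem k (V : {vspace 'cV[K]_m}) (A : 'M[K]_(m, k)) x :
  is_frame V A -> \dim V = k -> x \in V -> exists u : 'cV_k, x = A *m u.
Proof.
move=> AV dV; rewrite (frame_span AV dV) => /coord_span xE.
exists (\col_b coord [tuple col b A | b < k] b x).
rewrite mulmx_cols {1}xE; apply: eq_bigr => b _.
by rewrite mxE nth_mktuple.
Qed.

Lemma frame_change k (V : {vspace 'cV[K]_m}) (A B : 'M[K]_(m, k)) :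
  \dim V = k -> is_frame V A -> is_frame V B ->
  exists2 g : 'M_k, g \in unitmx & A = B *m g.
Proof.
move=> dV fA fB.
have ex b : {u : 'cV_k | B *m u == col b A}.
  apply/sigW; have [u uE] := frame_mem fB dV (fA.1 b).
  by exists u; rewrite uE.
pose g := \matrix_(c, b) (sval (ex b)) c 0.
have AE : A = B *m g.
  apply/matrixP => a b; have /eqP/colP/(_ a) := svalP (ex b).
  rewrite !mxE => <-; apply: eq_bigr => c _; by rewrite !mxE.
exists g => //; rewrite -row_full_unit; apply/row_fullP_inj => u gu.
by have /row_fullP_inj := fA.2; apply; rewrite AE -mulmxA gu mulmx0.
Qed.

End Frames.

(** * Minors, Pluecker coordinates and irreducibility *)

Section Minors.
Variables (K : fieldType) (m : nat).

(** The Cauchy-Binet formula before terms are grouped: expand [\det (Phi *m A)]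
    by multilinearity in the rows. *)
Lemma det_mulmx_rect k (Phi : 'M[K]_(k, m)) (A : 'M[K]_(m, k)) :
  \det (Phi *m A) =
  \sum_(h : {ffun 'I_k -> 'I_m}) (\prod_b Phi b (h b)) * \det (rowsub h A).
Proof.
transitivity (\sum_(s : 'S_k) \sum_(h : {ffun 'I_k -> 'I_m})
    (-1) ^+ s * \prod_b (Phi b (h b) * A (h b) (s b))).
  apply: eq_bigr => s _; rewrite -big_distrr /=; congr (_ * _).
  rewrite -(bigA_distr_bigA (fun b c => Phi b c * A c (s b))) /=.
  by apply: eq_bigr => b _; rewrite mxE.
rewrite exchange_big; apply: eq_bigr => h _ /=; rewrite big_distrr /=.
apply: eq_bigr => s _; rewrite big_split /= mulrCA; congr (_ * (_ * _)).
by apply: eq_bigr => b _; rewrite mxE.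
Qed.

(** Regrouping the terms of [det_mulmx_rect]: a choice of rows with a repetition
    contributes nothing, and any other differs from an increasing one by a
    permutation, whose sign does not depend on the matrix. *)
Lemma det_rowsub_subset k (h : 'I_k -> 'I_m) :
  (exists (I : subset_of_card m k) (c : K),
     forall A : 'M[K]_(m, k), \det (rowsub h A) = c * \det (rowsub (subset_row I) A))
  \/ (forall A : 'M[K]_(m, k), \det (rowsub h A) = 0).
Proof.
have [/injectiveP hI|/injectivePn[b [b' bb' hbb']]] := boolP (injectiveb h); last first.
  right=> A; apply: (determinant_alternate bb') => a.
  by rewrite !mxE hbb'.
left; pose I0 := h @: [set: 'I_k].
have cI : #|I0| == k by rewrite card_imset // cardsT card_ord.
pose I : subset_of_card m k := exist _ I0 cI; exists I.
have hI0 b : h b \in I0 by rewrite imset_f.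
pose sf b : 'I_k := cast_ord (eqP (valP I)) (enum_rank_in (hI0 b) (h b)).
have sfE b : subset_row I (sf b) = h b.
  by rewrite /subset_row /sf cast_ordK enum_rankK_in.
have sf_inj : injective sf by move=> b b' e; apply: hI; rewrite -!sfE e.
exists ((-1) ^+ perm sf_inj) => A.
rewrite -det_perm -det_mulmx -row_permE; congr (\det _).
by apply/matrixP => a b; rewrite !mxE permE sfE.
Qed.

End Minors.

Section Pluecker.
Local Open Scope classical_set_scope.
Variables (K : fieldType) (m n : nat) (d : 'I_n -> nat).
Local Notation poly := (pluecker_poly K m d).

(** Unlike [pluecker_eval], this depends polynomially on the matrices [A], which
    need not have full rank. *)
Definition minors_eval (A : forall i : 'I_n, 'M[K]_(m, d i)) (p : poly) : K :=
  p.@[fun k => let t := enum_val k in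
      \det (rowsub (subset_row (tagged t)) (A (tag t)))].

Definition has_multidegree (e : 'I_n -> nat) (p : poly) : Prop :=
  forall mon, mon \in msupp p ->
    forall i, (\sum_(k | tag (enum_val k) == i) mon k)%N = e i.

(** The torus of scalings, one for each projective space, acts on a
    multihomogeneous polynomial by a character. *)
Lemma meval_scale (c : 'I_n -> K) v e (p : poly) : has_multidegree e p ->
  p.@[fun k => c (tag (enum_val k)) * v k] = (\prod_i c i ^+ e i) * p.@[v].
Proof.
move=> pe; rewrite !mevalE big_distrr /= big_seq [RHS]big_seq; apply: eq_bigr => mon /pe monE.
rewrite mulrCA; congr (_ * _).
under eq_bigr do rewrite exprMn.
rewrite big_split /=; congr (_ * _).
rewrite (partition_big (fun k => tag (enum_val k)) xpredT) //=.
apply: eq_bigr => i _; rewrite -monE expr_sum.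
by apply: eq_bigr => k /eqP->.
Qed.

(** Two frames of a space differ by an invertible matrix, whose determinant
    scales all the minors of that space. *)
Lemma pluecker_eval_frame (V : grassmannian_prod K m d) A (p : poly) :
  (forall i, is_frame (val (V i)) (A i)) -> multihomogeneous p ->
  (pluecker_eval V p != 0) = (minors_eval A p != 0).
Proof.
move=> fA [e pe].
have ex i : {g : 'M[K]_(d i) | (g \in unitmx) && (A i == grassmannian_basis (V i) *m g)}.
  apply/sigW; have [g gu gE] := frame_change (eqP (valP (V i))) (fA i) (basis_is_frame (V i)).
  by exists g; rewrite gu gE eqxx.
pose c i := \det (sval (ex i)).
have c0 i : c i != 0.
  by have /andP[] := svalP (ex i); rewrite unitmxE unitfE.
have -> : minors_eval A p = (\prod_i c i ^+ e i) * pluecker_eval V p.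
  rewrite -meval_scale //; apply: meval_eq => k /=.
  have /andP[_ /eqP AE] := svalP (ex (tag (enum_val k))).
  by rewrite {1}AE -mul_rowsub_mx det_mulmx mulrC.
rewrite mulf_eq0 negb_or.
suff -> : \prod_i c i ^+ e i != 0 by [].
by apply/prodf_neq0 => i _; rewrite expf_neq0.
Qed.

(** The pullback of the determinant by [Phi] is a linear form in the Pluecker
    coordinates at [i]. *)
Lemma pluecker_linear_form (i : 'I_n) (Phi : 'M[K]_(d i, m)) :
  exists2 p : poly, multihomogeneous p &
    forall V, pluecker_eval V p = \det (Phi *m grassmannian_basis (V i)).
Proof.
pose e j := nat_of_bool (j == i).
suff [p pe pE] : exists2 p : poly, has_multidegree e p &
    forall V, pluecker_eval V p = \det (Phi *m grassmannian_basis (V i)).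
  by exists p => //; exists e.
have deg0 : has_multidegree e 0 by move=> mon; rewrite msupp0.
have degD p q : has_multidegree e p -> has_multidegree e q -> has_multidegree e (p + q).
  by move=> pe qe mon /msuppD_le; rewrite mem_cat => /orP[/pe|/qe].
have term (h : {ffun 'I_(d i) -> 'I_m}) : exists2 p : poly, has_multidegree e p &
    forall V, pluecker_eval V p =
      (\prod_b Phi b (h b)) * \det (rowsub h (grassmannian_basis (V i))).
  have [[I [c cE]]|zE] := det_rowsub_subset K h; last first.
    by exists 0 => // V; rewrite zE mulr0 /pluecker_eval meval0.
  pose t : pluecker_index m d := Tagged (fun i => subset_of_card m (d i)) I.
  exists (((\prod_b Phi b (h b)) * c) *: 'X_(enum_rank t)).
    move=> mon /msuppZ_le; rewrite msuppX inE => /eqP-> j.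
    rewrite (eq_bigr (fun k => nat_of_bool (enum_rank t == k))); last first.
      by move=> k _; rewrite mnm1E.
    rewrite big_mkcond (bigD1 (enum_rank t)) //= big1 => [|k /negbTE kt].
      by rewrite enum_rankK eqxx addn0 /e eq_sym; case: ifP.
    by rewrite [_ == k]eq_sym kt; case: ifP.
  by move=> V; rewrite /pluecker_eval mevalZ mevalXU enum_rankK /= cE mulrA.
have sums (s : seq {ffun 'I_(d i) -> 'I_m}) :
    exists2 p : poly, has_multidegree e p & forall V, pluecker_eval V p =
      \sum_(h <- s) (\prod_b Phi b (h b)) * \det (rowsub h (grassmannian_basis (V i))).
  elim: s => [|h s [q qe qE]].
    by exists 0 => // V; rewrite big_nil /pluecker_eval meval0.
  have [p pe pE] := term h.
  exists (p + q); first exact: degD.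
  by move=> V; rewrite big_cons -pE -qE /pluecker_eval mevalD.
have [p pe pE] := sums (index_enum _).
by exists p => // V; rewrite pE det_mulmx_rect.
Qed.

(** The complements of the zero sets of single multihomogeneous polynomials are a
    basis of the topology, and irreducibility says that nonempty open sets meet. *)
Lemma zariski_irreducibleP (X : set (grassmannian_prod K m d)) :
  zariski_irreducible X <->
  (exists V, X V) /\
  forall p q : poly, multihomogeneous p -> multihomogeneous q ->
    forall V W, X V -> X W -> pluecker_eval V p != 0 -> pluecker_eval W q != 0 ->
    exists U, [/\ X U, pluecker_eval U p != 0 & pluecker_eval U q != 0].
Proof.
split=> [[X0 irr]|[X0 meet]]; split=> //.
  move=> p q hp hq V W XV XW pV qW.
  pose F (r : poly) : set _ := [set U | pluecker_eval U r = 0].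
  have clF r : multihomogeneous r -> zariski_closed_in X (X `&` F r).
    move=> hr; exists (F r) => //; exists [set r].
      by move=> _ ->.
    by apply/seteqP; split=> U; [move=> Ur _ ->|apply].
  have [//|none] := boolp.pselect
    (exists U, [/\ X U, pluecker_eval U p != 0 & pluecker_eval U q != 0]).
  have XU : X = (X `&` F p) `|` (X `&` F q).
    apply/seteqP; split=> U; last by case=> -[].
    move=> XU; have [Up|Up] := eqVneq (pluecker_eval U p) 0; first by left.
    have [Uq|Uq] := eqVneq (pluecker_eval U q) 0; first by right.
    by case: none; exists U.
  case: (irr _ _ (clF p hp) (clF q hq) XU) => XE.
    by move: XV; rewrite XE => -[_ E]; rewrite E eqxx in pV.
  by move: XW; rewrite XE => -[_ E]; rewrite E eqxx in qW.
move=> _ _ [_ [S hS ->] ->] [_ [S' hS' ->] ->] XE.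
have sub (P : set poly) : X <> X `&` [set V | forall p, P p -> pluecker_eval V p = 0] ->
    exists V p, [/\ X V, P p & pluecker_eval V p != 0].
  move=> XP; apply: boolp.contrapT => none; apply: XP.
  apply/seteqP; split=> V; last by case.
  move=> XV; split=> // p Pp; apply/eqP; apply: boolp.contrapT => /negP Vp.
  by apply: none; exists V, p.
have [?|/sub[V [p [XV Sp Vp]]]] := boolp.pselect
  (X = X `&` [set V | forall p, S p -> pluecker_eval V p = 0]).
  by left.
have [?|/sub[W [q [XW Sq Wq]]]] := boolp.pselect
  (X = X `&` [set V | forall p, S' p -> pluecker_eval V p = 0]).
  by right.
have [U [XU Up Uq]] := meet p q (hS _ Sp) (hS' _ Sq) V W XV XW Vp Wq.
move: XU; rewrite XE => -[[_ /(_ _ Sp) E]|[_ /(_ _ Sq) E]].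
  by rewrite E eqxx in Up.
by rewrite E eqxx in Uq.
Qed.

End Pluecker.

(** * Families of frames and generic subrepresentations *)

Lemma dim_cV (K : fieldType) m : \dim {: 'cV[K]_m} = m.
Proof. by rewrite dimvf; exact: muln1. Qed.

(** This provides the subspaces [L] and [L'] of the necessity proof. *)
Lemma vspace_comparable (K : fieldType) (T : vectType K) (U : {vspace T}) k :
  (k <= \dim {: T})%N ->
  exists2 L : {vspace T}, \dim L = k & (U <= L)%VS \/ (L <= U)%VS.
Proof.
move=> kT; have [Uk|kU] := leqP (\dim U) k.
  have [|L [UL _ dL]] := @vspace_between _ _ U fullv k (subvf _); first by rewrite Uk.
  by exists L => //; left.
have [|L [_ LU dL]] := @vspace_between _ _ 0%VS U k (sub0v _).
  by rewrite dimv0 (ltnW kU).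
by exists L => //; right.
Qed.

Section Columns.
Variables (K : fieldType) (m : nat).
Implicit Types (g : 'End('cV[K]_m)).

Lemma lfun_mx g : exists P : 'M[K]_m, forall v, g v = P *m v.
Proof.
exists (cols_of m (fun b => if insub b is Some i then g (delta_mx i 0) else 0)) => v.
rewrite mulmx_cols {1}(matrix_sum_delta v) linear_sum.
by apply: eq_bigr => b _; rewrite big_ord1 linearZ col_cols_of valK.
Qed.

Lemma frame_image k (V : {vspace 'cV[K]_m}) g (s : nat -> 'cV[K]_m) :
  lker g == 0%VS -> is_frame V (cols_of k s) ->
  is_frame (g @: V) (cols_of k (fun b => g (s b))).
Proof.
move=> /lker0P g_inj [sV fs]; split=> [b|].
  by rewrite col_cols_of memv_img // -(col_cols_of s).
apply/row_fullP_inj => u; rewrite mulmx_cols => gu.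
move/row_fullP_inj: fs; apply; apply: g_inj; rewrite linear0 -[RHS]gu.
rewrite mulmx_cols linear_sum; apply: eq_bigr => b _.
by rewrite linearZ !col_cols_of.
Qed.

Lemma row_full_rowsub k (s : 'I_k -> 'I_m) (A : 'M[K]_(m, k)) :
  \det (rowsub s A) != 0 -> row_full A.
Proof.
move=> sA; apply/row_fullP_inj => u Au.
have usA : rowsub s A \in unitmx by rewrite unitmxE unitfE.
rewrite -[u](mulKmx usA) mul_rowsub_mx Au (_ : rowsub s 0 = 0) ?mulmx0 //.
by apply/matrixP => a b; rewrite !mxE.
Qed.

Lemma row_full_minor k (A : 'M[K]_(m, k)) :
  row_full A -> exists s : 'I_k -> 'I_m, \det (rowsub s A) != 0.
Proof.
move=> fA; exists (fullrankfun fA).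
by rewrite -unitfE -unitmxE; exact: fullrowsub_unit.
Qed.

End Columns.

Section PolynomialFamilies.
Variables (K : numFieldType) (m : nat).

Definition polyvec (v : K -> 'cV[K]_m) := forall a, polyfun (fun t => v t a 0).

Lemma polyvec_affine u v : polyvec (fun t => u + t *: v).
Proof.
move=> a; have [q qE] := polyfun_add (polyfun_cst (u a 0))
  (polyfun_mul (polyfun_id K) (polyfun_cst (v a 0))).
by exists q => t; rewrite -qE !mxE.
Qed.

Lemma polyvec_lfun (g : 'End('cV[K]_m)) v : polyvec v -> polyvec (fun t => g (v t)).
Proof.
move=> pv a; have [P gP] := lfun_mx g.
have [q qE] : polyfun (fun t => \sum_b P a b * v t b 0).
  by apply: polyfun_sum => b; apply: polyfun_mul => //; exact: polyfun_cst.
by exists q => t; rewrite -qE gP mxE.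
Qed.

Lemma polyfun_minors n (d : 'I_n -> nat) (s : K -> 'I_n -> nat -> 'cV[K]_m)
    (p : pluecker_poly K m d) :
  (forall i b, polyvec (fun t => s t i b)) ->
  polyfun (fun t => minors_eval (fun i => cols_of (d i) (s t i)) p).
Proof.
move=> ps.
have [q qE] : polyfun (fun t => \sum_(mon <- msupp p) p@_mon * \prod_k
    (\det (rowsub (subset_row (tagged (enum_val k)))
      (cols_of (d (tag (enum_val k))) (s t (tag (enum_val k)))))) ^+ mon k).
  apply: polyfun_sum => mon; apply: polyfun_mul; first exact: polyfun_cst.
  apply: polyfun_prod => k; apply/polyfun_exp/polyfun_det => a b.
  have [q qE] := ps (tag (enum_val k)) b (subset_row (tagged (enum_val k)) a).
  by exists q => t; rewrite -qE !mxE.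
by exists q => t; rewrite -qE /minors_eval mevalE.
Qed.

Lemma generic_row_full k (s : K -> nat -> 'cV[K]_m) t0 :
  (forall b, polyvec (fun t => s t b)) ->
  row_full (cols_of k (s t0)) -> generic (fun t => row_full (cols_of k (s t))).
Proof.
move=> ps /row_full_minor[h h0].
have ph : polyfun (fun t => \det (rowsub h (cols_of k (s t)))).
  apply: polyfun_det => a b; have [q qE] := ps b (h a).
  by exists q => t; rewrite -qE !mxE.
have [q q0 qh] := generic_neq0 ph h0.
by exists q => // t /qh; exact: row_full_rowsub.
Qed.

End PolynomialFamilies.

Section Flow.
Variables (K : fieldType) (m n : nat) (d : nat -> nat) (f : nat -> 'End('cV[K]_m)).
Hypothesis d_lt : forall k, (k.+1 < n)%N -> (d k < d k.+1)%N.

(** [C] collects free parameters, and [flow C i b] is the [b]-th vector at vertex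
    [i].  The first [d j] vectors at [j.+1] are images of those at [j], unless
    [f j = 0], when nothing is imposed.  If the vectors at each vertex are
    independent, they span a subrepresentation on which the nonzero [f j] are
    injective. *)
Fixpoint flow (C : nat -> nat -> 'cV[K]_m) (i b : nat) : 'cV[K]_m :=
  if i is j.+1 then
    if (f j != 0) && (b < d j)%N then f j (flow C j b) else C i b
  else C i b.

Lemma eq_flow C C' i b : (forall i b, C i b = C' i b) -> flow C i b = flow C' i b.
Proof. by move=> CC; elim: i => [|i IHi] /=; rewrite CC // IHi. Qed.

Fixpoint adapted_basis (W : nat -> {vspace 'cV[K]_m}) i : seq 'cV[K]_m :=
  if i is j.+1 then
    if f j != 0 then map (f j) (adapted_basis W j) ++ vbasis (W i :\: f j @: W j)
    else vbasis (W i)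
  else vbasis (W i).

Lemma adapted_basisP W i : nat_subrep n f W ->
  (forall k, (k.+1 < n)%N -> f k != 0 -> (W k :&: lker (f k) = 0)%VS) ->
  (i < n)%N -> basis_of (W i) (adapted_basis W i).
Proof.
move=> sW inj; elim: i => [|i IHi] iN /=; first exact: vbasisP.
have [_|fi0] := eqVneq (f i) 0; first exact: vbasisP.
rewrite [X in basis_of X](_ : _ = f i @: W i + (W i.+1 :\: f i @: W i))%VS; last first.
  by rewrite addvC addv_diff; apply/esym/addv_idPl/sW.
apply: cat_basis; last exact: vbasisP.
  by apply/directv_addP; rewrite capvC capv_diff.
by rewrite limg_basis_of ?inj // IHi // ltnW.
Qed.

(** The parameters can be taken to be a basis adapted to the representation: the
    flow then reproduces it. *)
Lemma flow_frame W : nat_subrep n f W ->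
  (forall k, (k < n)%N -> \dim (W k) = d k) ->
  (forall k, (k.+1 < n)%N -> f k != 0 -> (W k :&: lker (f k) = 0)%VS) ->
  exists C, forall i, (i < n)%N -> is_frame (W i) (cols_of (d i) (flow C i)).
Proof.
move=> sW dW inj; have bW i := adapted_basisP (i := i) sW inj.
have size_b i : (i < n)%N -> size (adapted_basis W i) = d i.
  move=> iN; rewrite -dW //.
  suff /vector.size_basis : basis_of (W i) (in_tuple (adapted_basis W i)) by [].
  exact: bW.
pose C i b := (adapted_basis W i)`_b; exists C => i iN.
have flowE b : flow C i b = C i b.
  elim: i iN b => // i IHi iN b /=; case: ifP => // /andP[fi0 bd].
  rewrite IHi ?(ltnW iN) // /C /= fi0 nth_cat size_map size_b ?(ltnW iN) // bd.
  by rewrite (nth_map 0) // size_b // ltnW.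
have -> : cols_of (d i) (flow C i) = cols_of (d i) (nth 0 (adapted_basis W i)).
  by apply/matrixP => a b; rewrite !mxE flowE.
split=> [b|]; last by rewrite row_full_cols_of ?size_b //; exact/basis_free/bW.
by rewrite col_cols_of; apply: (basis_mem (bW _ iN)); rewrite mem_nth ?size_b.
Qed.

Definition flow_span C i := <<[tuple col b (cols_of (d i) (flow C i)) | b < d i]>>%VS.

Lemma flow_subrep C : nat_subrep n f (flow_span C).
Proof.
move=> i iN; have [->|fi0] := eqVneq (f i) 0; first by rewrite lim0g sub0v.
rewrite limg_span; apply/span_subvP => _ /mapP[_ /tnthP[b ->] ->].
have bd : (b < d i.+1)%N by apply: ltn_trans (d_lt iN).
rewrite tnth_mktuple col_cols_of; apply: memv_span; apply/tnthP.
exists (Ordinal bd); rewrite tnth_mktuple col_cols_of /=.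
by rewrite fi0 ltn_ord.
Qed.

(** Preimages [f k @^-1: W k.+1] have dimension at least [\dim (W k.+1)] and images
    at most [\dim (W k)], so increasing dimensions leave room to extend a single
    space downwards and upwards. *)
Lemma subrep_through i0 V0 : (i0 < n)%N -> \dim V0 = d i0 ->
  (forall k, (k < n)%N -> (d k <= m)%N) ->
  exists W, [/\ nat_subrep n f W, forall k, (k < n)%N -> \dim (W k) = d k & W i0 = V0].
Proof.
move=> i0n dV0 dm.
pose Q a b := exists W : nat -> {vspace 'cV[K]_m}, [/\ W i0 = V0,
  forall k, (a <= k <= b)%N -> \dim (W k) = d k &
  forall k, (a <= k < b)%N -> (f k @: W k <= W k.+1)%VS].
suff [W [W0 dW sW]] : Q 0%N n.-1.
  by exists W; split=> // k kn; [apply: sW|apply: dW]; lia.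
have down j : (j <= i0)%N -> Q (i0 - j)%N i0.
  elim: j => [_|j IHj ji].
    by exists (fun=> V0); split=> // k; [move=> ?; have -> : k = i0 by lia|lia].
  have [W [W0 dW sW]] := IHj (ltnW ji); set a := (i0 - j.+1)%N.
  have Ea : (i0 - j)%N = a.+1 by rewrite /a; lia.
  rewrite Ea in dW sW.
  have da : (d a <= \dim (f a @^-1: W a.+1))%N.
    have := dim_preim_ge (f a) (W a.+1); have := dim_lker_limg (f a).
    by rewrite dW; have := @d_lt a; rewrite /a; lia.
  have [|U [_ UW dU]] := @vspace_between _ _ 0%VS _ (d a) (sub0v (f a @^-1: W a.+1)).
    by rewrite dimv0.
  exists (fun k => if k == a then U else W k); split=> [|k ka|k ka].
  - by rewrite ifN // /a; lia.
  - by have [->//|kNa] := eqVneq k a; apply: dW; lia.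
  - have [->|kNa] := eqVneq k a.
      rewrite ifN; last by lia.
      by apply/subvP => _ /memv_imgP[u /(subvP UW) uU ->]; rewrite memv_preim.
    by rewrite ifN; [apply: sW|]; lia.
have up j : (i0 + j < n)%N -> Q 0%N (i0 + j)%N.
  elim: j => [_|j IHj jn]; first by rewrite addn0 -(subnn i0); exact: down.
  rewrite addnS in jn *; have [W [W0 dW sW]] := IHj (ltnW jn).
  set b := (i0 + j)%N in jn W W0 dW sW *.
  have [|U [WU _ dU]] := @vspace_between _ _ _ _ (d b.+1) (subvf (f b @: W b)%VS).
    rewrite dim_cV dm // andbT; have := limg_ker_dim (f b) (W b).
    by rewrite dW; have := d_lt jn; lia.
  exists (fun k => if k == b.+1 then U else W k); split=> [|k kb|k kb].
  - by rewrite ifN // /b; lia.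
  - by have [->//|kNb] := eqVneq k b.+1; apply: dW; lia.
  - rewrite ifN; last by lia.
    by have [[->]//|kNb] := eqVneq k.+1 b.+1; apply: sW; lia.
have -> : n.-1 = (i0 + (n.-1 - i0))%N by lia.
by apply: up; lia.
Qed.

End Flow.

(** * The quiver Grassmannian *)

Section QuiverGrassmannian.
Variables (K : numFieldType) (m n : nat) (d : 'I_n -> nat)
  (f : 'I_n.-1 -> 'End('cV[K]_m)).
Hypothesis d_lt : forall i : 'I_n.-1, (d (arrow_src i) < d (arrow_tgt i))%N.
Hypothesis d_le : forall i : 'I_n, (d i <= m)%N.

(** The recursions along the quiver run over natural numbers; [x0] is a default
    value outside the range of indices. *)
Definition nat_ext A (x0 : A) k (F : 'I_k -> A) (i : nat) : A :=
  oapp F x0 (insub i).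

Lemma nat_extE A (x0 : A) k (F : 'I_k -> A) (i : 'I_k) : nat_ext x0 F i = F i.
Proof. by rewrite /nat_ext valK. Qed.

Local Notation dn := (nat_ext 0%N d).
Local Notation fn := (nat_ext 0 f).
Local Notation spaces V := (nat_ext 0%VS (fun i => val (V i))).
Local Notation X := (quiver_grassmannian f d).

Lemma arrow_at k : (k.+1 < n)%N -> exists2 i : 'I_n.-1, k = i &
  (k = arrow_src i :> nat) /\ (k.+1 = arrow_tgt i :> nat).
Proof.
move=> kn; have kn' : (k < n.-1)%N by lia.
by exists (Ordinal kn').
Qed.

Lemma dn_lt k : (k.+1 < n)%N -> (dn k < dn k.+1)%N.
Proof.
move=> /arrow_at[i _ [ks kt]]; rewrite kt ks !nat_extE; exact: d_lt.
Qed.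

Lemma dn_le k : (k < n)%N -> (dn k <= m)%N.
Proof. by move=> kn; rewrite (nat_extE _ _ (Ordinal kn)). Qed.

Lemma spaces_dim (V : grassmannian_prod K m d) k : (k < n)%N -> \dim (spaces V k) = dn k.
Proof.
by move=> kn; rewrite !(nat_extE _ _ (Ordinal kn)); exact/eqP/(valP (V (Ordinal kn))).
Qed.

Lemma spaces_subrep V : X V <-> nat_subrep n fn (spaces V).
Proof.
split=> [XV k /arrow_at[i ki [ks kt]]|sV i].
  by rewrite kt {2}ks ki !nat_extE; exact: XV.
have iN : (i.+1 < n)%N by rewrite -ltn_predRL.
have := sV i iN; rewrite nat_extE.
by rewrite -[i.+1]/(nat_of_ord (arrow_tgt i)) -[nat_of_ord i]/(nat_of_ord (arrow_src i)) !nat_extE.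
Qed.

Lemma point_of_spaces (W : nat -> {vspace 'cV[K]_m}) : nat_subrep n fn W ->
  (forall k, (k < n)%N -> \dim (W k) = dn k) ->
  exists2 V, X V & forall i : 'I_n, val (V i) = W i.
Proof.
move=> sW dW; have dW' (i : 'I_n) : \dim (W i) == d i.
  by rewrite dW // nat_extE.
exists (fun i : 'I_n => exist _ (W i) (dW' i)) => // i /=.
have iN : (i.+1 < n)%N by rewrite -ltn_predRL.
by have := sW i iN; rewrite nat_extE.
Qed.

Lemma point_through (i : 'I_n) (V0 : {vspace 'cV[K]_m}) : \dim V0 = d i ->
  exists2 V, X V & val (V i) = V0.
Proof.
move=> dV0; have dV0' : \dim V0 = dn i by rewrite nat_extE.
have [W [sW dW <-]] := subrep_through fn dn_lt (ltn_ord i) dV0' dn_le.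
by have [V XV VE] := point_of_spaces sW dW; exists V.
Qed.

Section Sufficiency.
Hypothesis corank_le : forall i : 'I_n.-1, f i != 0 ->
  (\dim (lker (f i)) <= d (arrow_tgt i) - d (arrow_src i))%N.

Lemma corank_le_nat k : (k.+1 < n)%N -> fn k != 0 ->
  (\dim (lker (fn k)) <= dn k.+1 - dn k)%N.
Proof.
move=> /arrow_at[i ki [ks kt]]; rewrite kt {3}ks ki !nat_extE; exact: corank_le.
Qed.

Definition injective_point (V : grassmannian_prod K m d) :=
  forall k, (k.+1 < n)%N -> fn k != 0 -> (spaces V k :&: lker (fn k) = 0)%VS.

(** Among the points where [p] does not vanish, one of maximal total rank is an
    injective point: otherwise the deformation would yield a better one, since
    [p] along it is polynomial in [t] and nonzero at [t = 0]. *)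
Lemma injective_points_dense V p : multihomogeneous p -> X V ->
  pluecker_eval V p != 0 ->
  exists V', [/\ X V', pluecker_eval V' p != 0 & injective_point V'].
Proof.
move=> hp; have [k] := ubnP (n * (n * m) - total_rank n fn (spaces V))%N.
elim: k V => // k IHk V rk_lt XV Vp.
have [/existsP[[i /= ltin] /and3P[iN fi0 Vi]]|good] := boolP [exists i : 'I_n,
    [&& (i.+1 < n)%N, fn i != 0 & (spaces V i :&: lker (fn i) != 0)%VS]]; last first.
  exists V; split=> // i iN fi0; apply/eqP; apply: contraNT good => Vi.
  by apply/existsP; exists (Ordinal (ltnW iN)); rewrite iN fi0.
have sV := (spaces_subrep V).1 XV.
have [N [c deform]] :=
  total_rank_deformation dn_lt corank_le_nat sV (spaces_dim V) iN fi0 Vi.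
pose g t j := (\1 + t *: N j)%VF.
pose s t (i : 'I_n) b := g t i (vbasis (val (V i)))`_b.
have gE t j v : g t j v = v + t *: N j v.
  by rewrite add_lfunE scale_lfunE id_lfunE.
have ps i' b : polyvec (fun t => s t i' b).
  move=> a; have [q qE] :=
    polyvec_affine (vbasis (val (V i')))`_b (N i' (vbasis (val (V i')))`_b) a.
  by exists q => t; rewrite -qE /s gE.
have pp := polyfun_minors p ps.
have [|q q0 qP] := generic_neq0 (t0 := 0) pp.
  rewrite -(@pluecker_eval_frame _ _ _ _ V) // => j.
  suff -> : cols_of (d j) (s 0 j) = grassmannian_basis (V j) by exact: basis_is_frame.
  by apply/matrixP => a b; rewrite !mxE /s gE scale0r addr0.
have [t] : exists t, [/\ t != 0, 1 + t * c != 0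
    & minors_eval (fun i => cols_of (d i) (s t i)) p != 0].
  have [|t [t0 [tc tp]]] := @generic_ex K (fun t => t != 0 /\ 1 + t * c != 0 /\
     minors_eval (fun i => cols_of (d i) (s t i)) p != 0); last by exists t.
  apply: generic_and.
    exact: (generic_neq0 (polyfun_id K) (oner_neq0 K)).
  apply: generic_and; last by exists q.
  apply: (@generic_neq0 _ _ 0).
    apply: polyfun_add (polyfun_cst 1) _.
    exact: polyfun_mul (polyfun_id K) (polyfun_cst c).
  by rewrite mul0r addr0 oner_neq0.
case=> t0 tc tp; have [g_inj sW W_rk] := deform t t0 tc.
have dW k' : (k' < n)%N -> \dim (g t k' @: spaces V k')%VS = dn k'.
  by move=> kn; rewrite dim_limg_inj ?g_inj // spaces_dim.
have [V' XV' V'E] := point_of_spaces sW dW.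
apply: (IHk V') => //.
  have rkE : total_rank n fn (spaces V') = total_rank n fn (fun k => g t k @: spaces V k)%VS.
    by apply: eq_bigr => a _; apply: eq_bigr => b _; rewrite nat_extE V'E.
  have := total_rank_bound n fn (spaces V'); rewrite dim_cV rkE.
  set r' := total_rank n fn (fun j => g t j @: _)%VS.
  have {W_rk} : (total_rank n fn (spaces V) < r')%N := W_rk.
  by clear - rk_lt; lia.
rewrite (pluecker_eval_frame (A := fun i => cols_of (d i) (s t i))) // => j.
rewrite V'E nat_extE; apply: frame_image; first exact: g_inj.
exact: basis_is_frame.
Qed.

(** On the line from [C1], at [t = 0], to [C2], at [t = 1], being a frame and not
    being a zero of [p] spread from a single [t0] to almost all [t]. *)
Lemma minors_flow_generic (C1 C2 : nat -> nat -> 'cV[K]_m) V p t0 :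
  let C t i b := C1 i b + t *: (C2 i b - C1 i b) in
  let A t := fun i : 'I_n => cols_of (d i) (flow dn fn (C t) i) in
  (forall i, is_frame (val (V i)) (A t0 i)) -> multihomogeneous p ->
  pluecker_eval V p != 0 ->
  generic (fun t => minors_eval (A t) p != 0 /\ forall i, row_full (A t i)).
Proof.
move=> C A fA hp Vp.
have pC i b : polyvec (fun t => flow dn fn (C t) i b).
  elim: i b => [|i IHi] b /=; first exact: polyvec_affine.
  by case: ((fn i != 0) && (b < dn i)%N); [exact: polyvec_lfun|exact: polyvec_affine].
apply: generic_and.
  apply: (generic_neq0 (t0 := t0)).
    exact: (polyfun_minors (s := fun t (i : 'I_n) => flow dn fn (C t) i)).
  by rewrite -(pluecker_eval_frame fA).
apply: generic_forall => i; apply: (generic_row_full (t0 := t0)) => //.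
by have [] := fA i.
Qed.

Lemma injective_point_flow V : X V -> injective_point V ->
  exists C, forall i : 'I_n, is_frame (val (V i)) (cols_of (d i) (flow dn fn C i)).
Proof.
move=> XV injV; have sV := (spaces_subrep V).1 XV.
have [C CV] := flow_frame sV (spaces_dim V) injV.
by exists C => i; have := CV i (ltn_ord i); rewrite !nat_extE.
Qed.

(** Move both points into the injective locus, join the parameters of the two
    new points by a line, and take a generic point of that line. *)
Lemma quiver_grassmannian_irreducible : (0 < n)%N -> zariski_irreducible X.
Proof.
move=> n0; apply/zariski_irreducibleP; split.
  pose i0 := Ordinal n0.
  have [|V0 [_ _ dV0]] := @vspace_between _ 'cV[K]_m 0%VS fullv (d i0) (sub0v _).
    by rewrite dimv0 dim_cV d_le.
  by have [V XV _] := point_through dV0; exists V.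
move=> p q hp hq V W XV XW Vp Wq.
have [V' [XV' V'p injV']] := injective_points_dense hp XV Vp.
have [W' [XW' W'q injW']] := injective_points_dense hq XW Wq.
have [C1 C1V] := injective_point_flow XV' injV'.
have [C2 C2W] := injective_point_flow XW' injW'.
pose C t i b := C1 i b + t *: (C2 i b - C1 i b).
have C0 i b : C 0 i b = C1 i b by rewrite /C scale0r addr0.
have C1E i b : C 1 i b = C2 i b by rewrite /C scale1r addrC subrK.
have flow_eq D D' : (forall i b, D i b = D' i b) ->
    forall i : 'I_n, cols_of (d i) (flow dn fn D i) = cols_of (d i) (flow dn fn D' i).
  by move=> DD i; apply/matrixP => a b; rewrite !mxE (eq_flow _ _ _ _ DD).
have gp := @minors_flow_generic C1 C2 V' p 0 _ hp V'p.
have gq := @minors_flow_generic C1 C2 W' q 1 _ hq W'q.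
have [||t [[tp fullA] [tq _]]] := generic_ex (generic_and (gp _) (gq _)).
- by move=> i; rewrite (flow_eq _ _ C0); exact: C1V.
- by move=> i; rewrite (flow_eq _ _ C1E); exact: C2W.
have dU k : (k < n)%N -> \dim (flow_span dn fn (C t) k) = dn k.
  move=> kn; have := fullA (Ordinal kn); rewrite -(nat_extE 0%N d (Ordinal kn)).
  by case/is_frame_span.
have [U XU UE] := point_of_spaces (flow_subrep fn dn_lt (C t)) dU.
have fU i : is_frame (val (U i)) (cols_of (d i) (flow dn fn (C t) i)).
  rewrite UE /flow_span nat_extE; by have [_] := is_frame_span (fullA i).
by exists U; split=> //; rewrite (pluecker_eval_frame fU).
Qed.

End Sufficiency.

(** Meeting [L] trivially is an open condition: some minor of the composite of
    the quotient map by [L] with a basis of the space is nonzero. *)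
Lemma transversality_open (i : 'I_n) (L : {vspace 'cV[K]_m}) V0 :
  (val (V0 i) :&: L = 0)%VS ->
  exists p : pluecker_poly K m d, [/\ multihomogeneous p, pluecker_eval V0 p != 0 &
    forall V, pluecker_eval V p != 0 -> (val (V i) :&: L = 0)%VS].
Proof.
move=> V0L; have [P PE] := lfun_mx (\1 - projv L)%VF.
have PL v : (P *m v == 0) = (v \in L).
  rewrite -PE add_lfunE opp_lfunE id_lfunE subr_eq0; apply/eqP/idP => [->|vL].
    exact: memv_proj.
  by rewrite projv_id.
have mem_basis (V : grassmannian_prod K m d) u : grassmannian_basis (V i) *m u \in val (V i).
  rewrite mulmx_cols; apply: rpred_sum => b _; apply: rpredZ.
  by have [] := basis_is_frame (V i).
have [|h h0] := @row_full_minor _ _ _ (P *m grassmannian_basis (V0 i)).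
  apply/row_fullP_inj => u /eqP; rewrite -mulmxA PL => uL.
  have /row_fullP_inj := (basis_is_frame (V0 i)).2; apply; apply/eqP.
  by rewrite -memv0 -V0L memv_cap uL mem_basis.
have [p hp pE] := pluecker_linear_form (rowsub h P).
exists p; split=> // [|V]; rewrite pE mul_rowsub_mx // => Vp.
apply/eqP; rewrite -subv0; apply/subvP => x; rewrite memv_cap memv0 => /andP[xV xL].
have [u xE] := frame_mem (basis_is_frame (V i)) (eqP (valP (V i))) xV.
move: xL; rewrite -PL xE mulmxA => /eqP Pu.
have u0 : u = 0 by move/row_fullP_inj: (row_full_rowsub Vp); apply.
by rewrite u0 mulmx0.
Qed.

(** A point transversal to both [L] and [L'] exists by irreducibility, as each
    condition is open and satisfied by some point of [X]. *)
Lemma irreducible_corank_le (i : 'I_n.-1) :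
  (0 < d (arrow_src i))%N -> (d (arrow_tgt i) < m)%N -> zariski_irreducible X ->
  (m <= (d (arrow_tgt i) - d (arrow_src i)) + \dim (limg (f i)))%N \/
  \dim (limg (f i)) = 0%N.
Proof.
move=> d0 em /zariski_irreducibleP[_ meet].
set a := arrow_src i in d0 *; set b := arrow_tgt i in em *.
have codim k : (m - k <= \dim {: 'cV[K]_m})%N by rewrite dim_cV leq_subr.
have [L dL KL] := vspace_comparable (lker (f i)) (codim (d a)).
have [L' dL' RL'] := vspace_comparable (limg (f i)) (codim (d b)).
have compl (j : 'I_n) (M : {vspace 'cV[K]_m}) : \dim M = (m - d j)%N ->
    exists2 V, X V & (val (V j) :&: M = 0)%VS.
  move=> dM; have [|V XV VE] := @point_through j (M^C)%VS.
    by rewrite dimv_compl dim_cV dM subKn ?d_le.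
  by exists V; rewrite // VE capvC capv_compl.
have [V XV VL] := compl a L dL; have [W XW WL'] := compl b L' dL'.
have [p [hp Vp pL]] := transversality_open VL.
have [q [hq Wq qL']] := transversality_open WL'.
have [U [XU /pL UL /qL' UL']] := meet p q hp hq V W XV XW Vp Wq.
have dimU j : \dim (val (U j)) = d j by exact/eqP/(valP (U j)).
have := corank_le_of_transversal (XU i) UL UL' KL RL'.
rewrite dL dL' dim_cV -/a -/b !dimU !subnKC ?d_le // => /(_ erefl erefl d0 em).
have ab : (d a < d b)%N := d_lt i.
case=> [le|]; last by right.
by left; rewrite -(leq_add2r (d a)) addnAC subnK ?(ltnW ab).
Qed.

End QuiverGrassmannian.

Theorem theorem3p4 (R : realType) (m n : nat) (d : 'I_n -> nat)
    (f : 'I_n.-1 -> 'End('cV[R[i]]_m))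
    (n_gt0 : (0 < n)%N) (n_lt_m : (n < m)%N)
    (d_bounds : forall i : 'I_n, (0 < d i < m)%N)
    (d_incr : forall i : 'I_n.-1, (d (arrow_src i) < d (arrow_tgt i))%N) :
  zariski_irreducible (quiver_grassmannian f d) <->
  (forall i : 'I_n.-1,
     (m - rk (f i) <= d (arrow_tgt i) - d (arrow_src i))%N \/ rk (f i) = 0%N).
Proof.
have d_le i : (d i <= m)%N by have /andP[_ /ltnW] := d_bounds i.
split=> [irr i|cond].
  have /andP[a0 _] := d_bounds (arrow_src i).
  have /andP[_ bm] := d_bounds (arrow_tgt i).
  have := irreducible_corank_le d_incr d_le a0 bm irr.
  by rewrite -/(rk (f i)) => -[?|->]; [left; lia|right].
apply: quiver_grassmannian_irreducible => // i fi0.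
have dimK : (\dim (lker (f i)) + rk (f i) = m)%N by rewrite dim_lker_limg dim_cV.
case: (cond i) => [|/eqP rk0].
  exact/leq_trans/eq_leq/(canRL (addnK _) dimK).
case/eqP: fi0; apply/lfunP => v; rewrite zero_lfunE; apply/eqP.
by rewrite -memv0 -(eqP (etrans (esym (dimv_eq0 _)) rk0)) memv_img ?memvf.
Qed.
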